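(* In the binary random graph affiliation mixture model with $Q\ge2$ groups, uniform group priors $\pi_q=1/Q$, and $\alpha\ne\beta$, let $m_1=\mathbb E(X_{12})$ and $m_{41}=\mathbb E(X_{12}X_{23}X_{34}X_{14})$. Then $m_{41}>m_1^4$.
   Context: Random graph mixture model: nodes have i.i.d. latent groups $Z_i\in\{1,\dots,Q\}$ with $\pi_q=\mathbb P(Z_i=q)$; edge variables $X_{ij}$ ($i<j$) are conditionally independent given all $Z$'s, with law of $X_{ij}$ depending only on $(Z_i,Z_j)$. Binary affiliation model: $X_{ij}\in\{0,1\}$ with $\mathbb P(X_{ij}=1\mid Z_i=q,Z_j=l)=\alpha$ if $q=l$ and $=\beta$ if $q\ne l$. *)

(* Defs.v *)
From HB Require Import structures.
From mathcomp Require Import all_boot all_order all_algebra.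
Set Implicit Arguments. Unset Strict Implicit. Unset Printing Implicit Defensive.
Import Order.TTheory GRing.Theory Num.Theory.
Local Open Scope ring_scope.

(* Binary affiliation random graph mixture model, restricted to the 4 nodes
   involved in the moments m_1 and m_41 (nodes 1,2,3,4 are 'I_4 indices 0..3). *)

Definition node := 'I_4.

Definition edge := {p : node * node | (p.1 < p.2)%N}.

Definition outcome (Q : nat) := ({ffun node -> 'I_Q} * {ffun edge -> bool})%type.

Definition affil (R : nzRingType) (Q : nat) (alpha beta : R) (q l : 'I_Q) : R :=
  if q == l then alpha else beta.

(* Joint law: Z_i i.i.d. with law pi, X_ij conditionally independent Bernoulli
   given Z with parameter affil (Z_i) (Z_j). *)
Definition pmf (R : nzRingType) (Q : nat) (pi : 'I_Q -> R) (alpha beta : R)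
    (w : outcome Q) : R :=
  (\prod_(i : node) pi (w.1 i)) *
  \prod_(e : edge)
     (let p := affil alpha beta (w.1 (val e).1) (w.1 (val e).2) in
      if w.2 e then p else 1 - p).

Definition Expect (R : nzRingType) (Q : nat) (pi : 'I_Q -> R) (alpha beta : R)
    (f : outcome Q -> R) : R :=
  \sum_(w : outcome Q) pmf pi alpha beta w * f w.

(* Edge variable X_ij (as 0/1 in R); defined for i < j, and 0 otherwise (unused). *)
Definition Xv (R : nzRingType) (Q : nat) (i j : node) (w : outcome Q) : R :=
  if @insub _ (fun p : node * node => (p.1 < p.2)%N) edge (i, j) is Some e
  then (w.2 e)%:R else 0.

Definition n1 : node := inord 0.
Definition n2 : node := inord 1.
Definition n3 : node := inord 2.
Definition n4 : node := inord 3.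

Definition uniform_prior (R : fieldType) (Q : nat) : 'I_Q -> R := fun _ => (Q%:R)^-1.

Definition m1 (R : fieldType) (Q : nat) (alpha beta : R) : R :=
  @Expect R Q (@uniform_prior R Q) alpha beta (fun w => @Xv R Q n1 n2 w).

Definition m41 (R : fieldType) (Q : nat) (alpha beta : R) : R :=
  @Expect R Q (@uniform_prior R Q) alpha beta
    (fun w => @Xv R Q n1 n2 w * @Xv R Q n2 n3 w * @Xv R Q n3 n4 w * @Xv R Q n1 n4 w).

(* Main.v *)
Require Import Defs.
From mathcomp Require Import all_boot all_order all_algebra ring.
Import Order.TTheory GRing.Theory Num.Theory.
Local Open Scope ring_scope.

(* Integrating out the edges turns a moment of edge indicators into a sum over
   group labels of products of affiliation probabilities.  Writing
   [A = beta J + (alpha - beta) I] for the Q x Q connectivity matrix,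
   [m1 = 1'A1 / Q^2 = (Q beta + d) / Q] and [m41 = tr(A^4) / Q^4], and the
   spectrum of A (Q beta + d once, d = alpha - beta with multiplicity Q - 1)
   gives [m41 = m1^4 + (Q - 1) (d / Q)^4].  This identity holds for arbitrary
   alpha and beta. *)

Section BernoulliMarginal.
Variable R : comNzRingType.

Lemma sum_bernoulli_prod (I : finType) (p : I -> R) (s : seq I) : uniq s ->
  \sum_(X : {ffun I -> bool})
     (\prod_i (if X i then p i else 1 - p i)) * \prod_(i <- s) (X i)%:R
  = \prod_(i <- s) p i.
Proof.
move=> us; rewrite [RHS](big_uniq _ us) [RHS]big_mkcond /=.
pose F i (b : bool) := (if b then p i else 1 - p i) * (if i \in s then b%:R else 1).
transitivity (\sum_(X : {ffun I -> bool}) \prod_i F i (X i)).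
  by apply: eq_bigr => X _; rewrite big_split /= -big_mkcond (big_uniq _ us).
rewrite -(@bigA_distr_bigA _ 0 1 *%R +%R _ _ F); apply: eq_bigr => i _.
by rewrite big_bool /F; case: (i \in s); rewrite /= ?mulr1 ?mulr0 ?addr0 // addrC subrK.
Qed.

Lemma sum_delta (T : finType) (f : T -> R) (a : T) :
  \sum_b f b * (a == b)%:R = f a.
Proof.
rewrite (bigD1 a) //= eqxx mulr1 big1 ?addr0 // => b nb.
by rewrite eq_sym (negbTE nb) mulr0.
Qed.

Lemma Expect_prod_edges Q (pi : 'I_Q -> R) (al be : R) (s : seq edge) : uniq s ->
  Expect pi al be (fun w => \prod_(e <- s) (w.2 e)%:R) =
  \sum_(Z : {ffun node -> 'I_Q})
     (\prod_i pi (Z i)) * \prod_(e <- s) affil al be (Z (val e).1) (Z (val e).2).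
Proof.
move=> us; rewrite /Expect.
rewrite (eq_bigr (fun w => pmf pi al be (w.1, w.2) * \prod_(e <- s) (w.2 e)%:R));
  last by case.
rewrite -(pair_bigA _ (fun Z X => pmf pi al be (Z, X) * \prod_(e <- s) (X e)%:R)) /=.
apply: eq_bigr => Z _; rewrite /pmf /=.
under eq_bigr do rewrite -mulrA.
by rewrite -mulr_sumr sum_bernoulli_prod.
Qed.

End BernoulliMarginal.

Lemma nat_of_nodes :
  [/\ (n1 : nat) = 0, (n2 : nat) = 1, (n3 : nat) = 2 & (n4 : nat) = 3]%N.
Proof. by rewrite /n1 /n2 /n3 /n4 !inordK. Qed.

Lemma sum_labellings {R : nmodType} {Q} (G : 'I_Q -> 'I_Q -> 'I_Q -> 'I_Q -> R) :
  \sum_(Z : {ffun node -> 'I_Q}) G (Z n1) (Z n2) (Z n3) (Z n4) =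
  \sum_a \sum_b \sum_c \sum_d G a b c d.
Proof.
have [e1 e2 e3 e4] := nat_of_nodes.
pose g (t : 'I_Q * ('I_Q * ('I_Q * 'I_Q))) :=
  [ffun i : node => nth t.1 [:: t.1; t.2.1; t.2.2.1; t.2.2.2] i].
pose h (Z : {ffun node -> 'I_Q}) := (Z n1, (Z n2, (Z n3, Z n4))).
have gK : cancel g h by case=> a [b [c d]]; rewrite /h /g !ffunE e1 e2 e3 e4.
have hK : cancel h g.
  move=> Z; apply/ffunP => i; rewrite ffunE /h /=.
  by case: i => [[|[|[|[|//]]]] Hi] /=; congr (Z _); apply: val_inj.
rewrite (reindex g (onW_bij _ (Bijective gK hK))) /=.
symmetry; under eq_bigr do under eq_bigr do rewrite pair_bigA.
under eq_bigr do rewrite pair_bigA.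
rewrite pair_bigA; apply: eq_bigr => -[a [b [c d]]] _ /=.
by rewrite /g !ffunE e1 e2 e3 e4.
Qed.

Section AffiliationSums.
Variables (R : comNzRingType) (Q : nat) (al be : R).
Local Notation A := (@affil R Q al be).

Lemma affilE a b : A a b = be + (al - be) * (a == b)%:R.
Proof. by rewrite /affil; case: eqP => _; rewrite /= ?mulr1 ?mulr0 ?addr0 // addrC subrK. Qed.

Lemma affilC a b : A a b = A b a.
Proof. by rewrite /affil eq_sym. Qed.

Lemma sum_affil a : \sum_b A a b = Q%:R * be + (al - be).
Proof.
under eq_bigr do rewrite affilE.
by rewrite big_split /= sumr_const card_ord sum_delta mulr_natl.
Qed.

Lemma sum_affil_path2 a c :
  \sum_b A a b * A b c =
  Q%:R * be ^+ 2 + 2 * be * (al - be) + (al - be) ^+ 2 * (a == c)%:R.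
Proof.
have splitE b : A a b * A b c = be ^+ 2 + be * (al - be) * (c == b)%:R
    + (be * (al - be) + (al - be) ^+ 2 * (c == a)%:R) * (a == b)%:R.
  rewrite !affilE (eq_sym b c).
  by case: (a =P b) => [<-|_]; rewrite ?eqxx /=; ring.
under eq_bigr do rewrite splitE.
rewrite !big_split /= sumr_const card_ord !sum_delta (eq_sym c a) -mulr_natl.
ring.
Qed.

Lemma sum_affil_edge :
  \sum_a \sum_b \sum_(c : 'I_Q) \sum_(d : 'I_Q) A a b = Q%:R ^+ 3 * (Q%:R * be + (al - be)).
Proof.
under eq_bigr do under eq_bigr do under eq_bigr do rewrite sumr_const card_ord.
under eq_bigr do under eq_bigr do rewrite sumrMnl sumr_const card_ord.
under eq_bigr do rewrite sumrMnl sumrMnl sum_affil.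
by rewrite sumr_const card_ord; ring.
Qed.

Lemma sum_affil_cycle4 :
  \sum_a \sum_b \sum_c \sum_d A a b * A b c * A c d * A d a =
  (Q%:R * be + (al - be)) ^+ 4 + (Q%:R - 1) * (al - be) ^+ 4.
Proof.
set K := Q%:R * be ^+ 2 + 2 * be * (al - be); set v := (al - be) ^+ 2.
have sqrE (x : bool) : (K + v * x%:R) ^+ 2 = K ^+ 2 + (2 * K * v + v ^+ 2) * x%:R.
  by case: x; rewrite /= ?mulr0 ?mulr1; ring.
have pathsE a c : \sum_b \sum_d A a b * A b c * A c d * A d a = (K + v * (a == c)%:R) ^+ 2.
  rewrite expr2 {2}(eq_sym a c) -!sum_affil_path2.
  by rewrite big_distrlr; apply: eq_bigr => b _; apply: eq_bigr => d _; rewrite /= !mulrA.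
under eq_bigr do rewrite exchange_big /=.
under eq_bigr do under eq_bigr do rewrite pathsE sqrE.
under eq_bigr do rewrite big_split /= sumr_const card_ord sum_delta.
rewrite sumr_const card_ord /K /v; ring.
Qed.

End AffiliationSums.

Lemma n1_lt_n2 : (n1 < n2)%N. Proof. by have [-> -> _ _] := nat_of_nodes. Qed.
Lemma n2_lt_n3 : (n2 < n3)%N. Proof. by have [_ -> -> _] := nat_of_nodes. Qed.
Lemma n3_lt_n4 : (n3 < n4)%N. Proof. by have [_ _ -> ->] := nat_of_nodes. Qed.
Lemma n1_lt_n4 : (n1 < n4)%N. Proof. by have [-> _ _ ->] := nat_of_nodes. Qed.

Definition e12 : edge := Sub (n1, n2) n1_lt_n2.
Definition e23 : edge := Sub (n2, n3) n2_lt_n3.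
Definition e34 : edge := Sub (n3, n4) n3_lt_n4.
Definition e14 : edge := Sub (n1, n4) n1_lt_n4.

Lemma uniq_cycle_edges : uniq [:: e12; e23; e34; e14].
Proof.
have [e1 e2 e3 e4] := nat_of_nodes.
rewrite /= !inE -!(inj_eq val_inj) /= !xpair_eqE -!(inj_eq val_inj) /=.
by rewrite e1 e2 e3 e4.
Qed.

Lemma XvE {R : nzRingType} {Q} {i j : node} (lt_ij : (i < j)%N) (w : outcome Q) :
  Xv R i j w = (w.2 (Sub (i, j) lt_ij : edge))%:R.
Proof. by rewrite /Xv insubT. Qed.

Section UniformMoments.
Variables (R : fieldType) (Q : nat) (al be : R).

Lemma uniform_prior_prod (Z : {ffun node -> 'I_Q}) :
  \prod_i uniform_prior R (Z i) = Q%:R ^- 4.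
Proof. by rewrite /uniform_prior prodr_const card_ord exprVn. Qed.

Lemma m1E : Q%:R != 0 :> R -> m1 Q al be = (Q%:R * be + (al - be)) / Q%:R.
Proof.
move=> Q0; rewrite /m1.
have -> : Expect (@uniform_prior R Q) al be (Xv R n1 n2) =
    Expect (@uniform_prior R Q) al be (fun w => \prod_(e <- [:: e12]) (w.2 e)%:R).
  by apply: eq_bigr => w _; rewrite big_seq1 (XvE n1_lt_n2).
rewrite Expect_prod_edges //.
under eq_bigr do rewrite big_seq1 uniform_prior_prod.
rewrite -mulr_sumr (sum_labellings (fun a b c d => affil al be a b)) sum_affil_edge.
by field.
Qed.

Lemma m41E :
  m41 Q al be = ((Q%:R * be + (al - be)) ^+ 4 + (Q%:R - 1) * (al - be) ^+ 4) / Q%:R ^+ 4.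
Proof.
rewrite /m41.
have -> : Expect (@uniform_prior R Q) al be
      (fun w => Xv R n1 n2 w * Xv R n2 n3 w * Xv R n3 n4 w * Xv R n1 n4 w) =
    Expect (@uniform_prior R Q) al be
      (fun w => \prod_(e <- [:: e12; e23; e34; e14]) (w.2 e)%:R).
  apply: eq_bigr => w _; rewrite !big_cons big_nil mulr1 !mulrA.
  by rewrite (XvE n1_lt_n2) (XvE n2_lt_n3) (XvE n3_lt_n4) (XvE n1_lt_n4).
rewrite Expect_prod_edges; last exact: uniq_cycle_edges.
under eq_bigr do rewrite !big_cons big_nil mulr1 uniform_prior_prod.
rewrite -mulr_sumr mulrC.
rewrite (sum_labellings
  (fun a b c d => affil al be a b * (affil al be b c * (affil al be c d * affil al be a d)))).
rewrite -sum_affil_cycle4; congr (_ * _).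
apply: eq_bigr => a _; apply: eq_bigr => b _; apply: eq_bigr => c _.
by apply: eq_bigr => d _; rewrite !mulrA [affil _ _ d a]affilC.
Qed.

Lemma m41_m1E : Q%:R != 0 :> R ->
  m41 Q al be = m1 Q al be ^+ 4 + (Q%:R - 1) * ((al - be) / Q%:R) ^+ 4.
Proof. by move=> Q0; rewrite m41E m1E //; field. Qed.

End UniformMoments.

Theorem lemma4 (R : realFieldType) (Q : nat) (alpha beta : R)
  (hQ : (2 <= Q)%N)
  (ha : 0 <= alpha <= 1) (hb : 0 <= beta <= 1) (hab : alpha != beta) :
  m41 Q alpha beta > (m1 Q alpha beta) ^+ 4.
Proof.
have Q_gt0 : (0 : R) < Q%:R by rewrite ltr0n (leq_trans _ hQ).
rewrite m41_m1E ?gt_eqF // ltrDl mulr_gt0 //.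
  by rewrite subr_gt0 ltr1n.
by rewrite exprn_even_gt0 //= mulf_neq0 ?subr_eq0 // invr_eq0 gt_eqF.
Qed.
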